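(* For every $n\ge 1$ there is a bijection between the set of partial permutations of length $n$ with exactly one hole that avoid $1234$ and the set of all lattice paths from $(0,0)$ to $(2n-2,0)$ with steps $(1,1)$ and $(1,-1)$.
   Context: A partial permutation of length $n$ with one hole is a sequence $\pi_1\cdots\pi_n$ in which each of $1,\dots,n-1$ appears exactly once and the remaining entry is a hole symbol $\diamond$. A permutation $\sigma$ of $[n]$ is an extension of $\pi$ if the standardization (order-preserving relabeling by $1,2,\dots$) of the restriction of $\sigma$ to the non-hole positions equals the restriction of $\pi$ to those positions. $\pi$ avoids a pattern $p$ if every extension of $\pi$ avoids $p$ in the classical sense. *)

(* Defs.v *)
From mathcomp Require Import all_boot all_order all_algebra all_fingroup.
Set Implicit Arguments.
Unset Strict Implicit.
Unset Printing Implicit Defensive.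
Import GRing.Theory.

(* Each entry is replaced by its rank (starting from 1); meant for words with
   pairwise distinct entries. *)
Definition standardize (w : seq nat) : seq nat :=
  [seq count (fun y => y <= x) w | x <- w].

Definition contains (p w : seq nat) : bool :=
  [exists m : (size w).-tuple bool, standardize (mask m w) == p].

(* 'S_n permutes {0, ..., n - 1}, hence the shift by one. *)
Definition one_line (n : nat) (s : 'S_n) : seq nat :=
  [seq (s i : nat).+1 | i <- enum 'I_n].

(* [None] is the hole and [Some v] is the entry v itself, with no shift: only
   the values 1, ..., n - 1 of 'I_n are used. As there are n positions, the
   counts below rule out the entry 0. *)
Definition one_hole (n : nat) (w : n.-tuple (option 'I_n)) : bool :=
  (count_mem None w == 1) &&
  [forall v : 'I_n, (0 < v) ==> (count_mem (Some v) w == 1)].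

Definition extension (n : nat) (w : n.-tuple (option 'I_n)) (s : 'S_n) : bool :=
  standardize [seq (s i : nat).+1 | i <- enum 'I_n & tnth w i != None]
  == [seq nat_of_ord v | v <- pmap id w].

Definition avoids (n : nat) (w : n.-tuple (option 'I_n)) (p : seq nat) : bool :=
  [forall s : 'S_n, extension w s ==> ~~ contains p (one_line s)].

(* A path starting at P is given by its sequence of steps. *)
Definition lattice_path (steps : seq (int * int)) (P Q : int * int)
    (t : seq (int * int)) : bool :=
  all (fun u => u \in steps) t && (P + \sum_(u <- t) u == Q)%R.

(* Main.v *)
Require Import Defs.
From mathcomp Require Import all_boot all_order all_algebra all_fingroup.
From mathcomp Require Import zify.

(* Let u be the permutation of [n - 1] left after deleting the hole of a partial
   permutation.  Deleting the letter at the hole from an occurrence of 1234 in an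
   extension leaves an occurrence of 123 in u; conversely, wherever the hole is,
   it can receive a value turning a given occurrence of 123 in u into one of
   1234.  So the partial permutation avoids 1234 iff u avoids 123, and the hole
   is free: there are n Cat(n - 1) = 'C(2n - 2, n - 1) of them, as many as
   lattice paths.  The Catalan count of 123-avoiders comes from inserting a new
   maximum: the allowed places are those within or at the ends of the longest
   decreasing prefix, and a prefix of length d yields prefixes of length
   1, 2, ..., d + 1, once each. *)

Set Implicit Arguments.
Unset Strict Implicit.
Unset Printing Implicit Defensive.

Import GRing.Theory.

(** * Bijections between enumerated sets *)

(** Both lists enumerate their sets without repetition, so matching elements at equal indices works
    in both directions. A bijection thus reduces to a count. *)
Lemma bijective_of_lists (T1 T2 : eqType) (P1 : pred T1) (P2 : pred T2)
    (L1 : seq T1) (L2 : seq T2) :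
  uniq L1 -> uniq L2 -> L1 =i P1 -> L2 =i P2 -> size L1 = size L2 ->
  exists f : {x : T1 | P1 x} -> {y : T2 | P2 y}, bijective f.
Proof.
move=> U1 U2 E1 E2 eqsz.
have lt1 (x : {x | P1 x}) : index (val x) L1 < size L2.
  by rewrite -eqsz index_mem E1; exact: valP x.
have lt2 (y : {y | P2 y}) : index (val y) L2 < size L1.
  by rewrite eqsz index_mem E2; exact: valP y.
have P2f x : P2 (tnth (in_tuple L2) (Ordinal (lt1 x))).
  by have := mem_tnth (Ordinal (lt1 x)) (in_tuple L2); rewrite E2.
have P1g y : P1 (tnth (in_tuple L1) (Ordinal (lt2 y))).
  by have := mem_tnth (Ordinal (lt2 y)) (in_tuple L1); rewrite E1.
exists (fun x => exist (fun y => P2 y) _ (P2f x)).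
exists (fun y => exist (fun x => P1 x) _ (P1g y)) => [x|y]; apply: val_inj => /=.
  rewrite (tnth_nth (val x)) /= (tnth_nth (tnth (in_tuple L2) (Ordinal (lt1 x)))) /=.
  by rewrite index_uniq ?lt1 // nth_index // E1; exact: valP x.
rewrite (tnth_nth (val y)) /= (tnth_nth (tnth (in_tuple L1) (Ordinal (lt2 y)))) /=.
by rewrite index_uniq ?lt2 // nth_index // E2; exact: valP y.
Qed.

(** * Inserting a letter into a word and removing it *)

Definition insert_at (T : Type) (j : nat) (x : T) (s : seq T) : seq T :=
  take j s ++ x :: drop j s.

Lemma size_insert_at (T : Type) j (x : T) s :
  size (insert_at j x s) = (size s).+1.
Proof. by rewrite size_cat /= addnS -size_cat cat_take_drop. Qed.

Lemma map_insert_at (T U : Type) (f : T -> U) j x s :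
  map f (insert_at j x s) = insert_at j (f x) (map f s).
Proof. by rewrite /insert_at map_cat /= map_take map_drop. Qed.

Lemma perm_insert_at (T : eqType) j (x : T) s :
  perm_eq (insert_at j x s) (x :: s).
Proof. by rewrite perm_catC /= perm_cons perm_catC cat_take_drop. Qed.

Lemma subseq_insert_at (T : eqType) j (x : T) s : subseq s (insert_at j x s).
Proof.
by rewrite -{1}(cat_take_drop j s) cat_subseq ?subseq_refl ?subseq_cons.
Qed.

Lemma index_insert_at (T : eqType) j (x : T) s :
  x \notin s -> j <= size s -> index x (insert_at j x s) = j.
Proof.
move=> xs js; rewrite index_cat /= eqxx addn0 size_takel //.
by case: ifP => // /mem_take; rewrite (negPf xs).
Qed.

Lemma rem_insert_at (T : eqType) j (x : T) s :
  x \notin s -> rem x (insert_at j x s) = s.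
Proof.
elim: s j => [|y s IH] [|j] //=; rewrite ?eqxx //.
rewrite inE negb_or /insert_at /= => /andP[xy xs].
by rewrite eq_sym (negPf xy) -/(insert_at j x s) IH.
Qed.

Lemma insert_at_rem (T : eqType) (x : T) s :
  x \in s -> insert_at (index x s) x (rem x s) = s.
Proof.
elim: s => //= y s IH; rewrite inE [x == y]eq_sym.
case: eqVneq => [->|yx] /= xs; first by rewrite /insert_at take0 drop0.
by rewrite /insert_at /= -/(insert_at _ _ _) IH.
Qed.

Lemma insert_at_inj (T : eqType) (x : T) i j s t :
  x \notin s -> x \notin t -> i <= size s -> j <= size t ->
  insert_at i x s = insert_at j x t -> i = j /\ s = t.
Proof.
move=> xs xt ils jlt E; split; last by rewrite -(rem_insert_at i xs) E rem_insert_at.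
by rewrite -(index_insert_at xs ils) E index_insert_at.
Qed.

(** * Increasing patterns *)

Lemma standardize_map (f : nat -> nat) w :
  {in w &, {mono f : x y / x <= y}} -> standardize (map f w) = standardize w.
Proof.
move=> fm; rewrite /standardize -map_comp; apply/eq_in_map => x xw /=.
by rewrite count_map; apply: eq_in_count => y yw /=; rewrite fm.
Qed.

Lemma standardize_perm_iota m w :
  perm_eq w (iota 1 m) -> standardize w = w.
Proof.
move=> wp; rewrite -[RHS]map_id; apply/eq_in_map => x.
rewrite (seq.permP wp) (perm_mem wp) mem_iota add1n ltnS => /andP[x0 xm].
(* Cut [iota 1 m] after [x]: the first [x] values are all counted and the others never, so the rank
   of [x] is [x]. *)
rewrite -(subnKC xm) iotaD count_cat.
rewrite (eq_in_count (a2 := predT)) => [|y]; last by rewrite mem_iota /=; lia.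
rewrite [X in _ + X](eq_in_count (a2 := pred0)) => [|y]; last by rewrite mem_iota /=; lia.
by rewrite count_predT count_pred0 size_iota addn0.
Qed.

(** Raising the threshold from [x] to [y] adds the entries above [x] and at most [y], among them [y]
    itself. *)
Lemma standardize_homo r :
  {in r &, {homo (fun x => count (fun y => y <= x) r) : x y / x < y}}.
Proof.
move=> x y xr yr xy; pose b := fun z => x < z <= y.
rewrite [ltnRHS](eq_count (a2 := predU (fun z => z <= x) b)); last first.
  by move=> z /=; rewrite /b; lia.
(* The added zero is the count of an empty intersection, as needed for [count_predUI]. *)
rewrite -[ltnRHS]addn0 -(count_pred0 r) (eq_count (a1 := pred0) (a2 := predI (fun z => z <= x) b)); last first.
  by move=> z /=; rewrite /b; lia.
rewrite count_predUI -[ltnLHS]addn0 ltn_add2l -has_count.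
by apply/hasP; exists y => //; rewrite /b; lia.
Qed.

(** Ranks grow weakly with the entries, so strictly increasing ranks force strictly increasing
    entries. Conversely, the head of an increasing word has rank 1 and adds 1 to every later
    rank. *)
Lemma standardize_increasing t :
  (standardize t == iota 1 (size t)) = sorted ltn t.
Proof.
apply/eqP/idP => [E|].
  have : sorted ltn (standardize t) by rewrite E iota_ltn_sorted.
  rewrite /standardize sorted_map; apply: sub_sorted => x y /=.
  apply: contraLR; rewrite -!leqNgt => yx; apply: sub_count => z /=; lia.
elim: t => //= x t IH xt; have /IH {}IH := path_sorted xt.
have xt' : all (ltn x) t by apply: order_path_min xt; apply: ltn_trans.
rewrite /standardize /= leqnn; congr cons.
  rewrite add1n; congr S; rewrite -(count_pred0 t); apply: eq_in_count => y yt /=.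
  by apply/negbTE; rewrite -ltnNge; exact: (allP xt').
rewrite -[2]/(1+1) iotaDl -IH /standardize -map_comp; apply/eq_in_map => y yt /=.
by rewrite (ltnW (allP xt' _ yt)).
Qed.

Lemma contains_increasingP k w :
  reflect (exists t, [/\ subseq t w, sorted ltn t & size t = k])
    (contains (iota 1 k) w).
Proof.
apply: (iffP existsP) => [[b /eqP E]|[_ [/subseqP[b szb ->] st szt]]].
  have sz : size (mask b w) = k by rewrite -(size_iota 1 k) -E size_map.
  exists (mask b w); split=> //; first exact: mask_subseq.
  by rewrite -standardize_increasing sz E.
exists (tcast szb (in_tuple b)); rewrite val_tcast /=.
by rewrite -szt standardize_increasing.
Qed.

Lemma contains_increasing_leq k w t :
  subseq t w -> sorted ltn t -> k <= size t -> contains (iota 1 k) w.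
Proof.
move=> tw st kt; apply/contains_increasingP; exists (take k t); split.
- exact: subseq_trans (take_subseq _ _) tw.
- exact: take_sorted.
- exact: size_takel.
Qed.

Lemma contains_increasing_subseq k s w :
  subseq s w -> contains (iota 1 k) s -> contains (iota 1 k) w.
Proof.
move=> sw /contains_increasingP[t [ts st szt]].
by apply: (contains_increasing_leq (t := t)); rewrite ?szt // (subseq_trans ts).
Qed.

Lemma contains_increasing_standardize k r :
  contains (iota 1 k) r -> contains (iota 1 k) (standardize r).
Proof.
move=> /contains_increasingP[t [tr st szt]].
pose c x := count (fun y => y <= x) r.
apply: (contains_increasing_leq (t := map c t)); last by rewrite size_map szt.
  exact: map_subseq.
rewrite sorted_map; apply: (sub_in_sorted (P := mem r)) st => [x y xr yr /=|].
  exact: standardize_homo.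
by apply/allP => x /(mem_subseq tr).
Qed.

(** Dropping [x] from an occurrence costs at most one letter, and what is left is a subsequence of
    [s]. *)
Lemma contains_increasing_insert k j x s :
  x \notin s -> contains (iota 1 k.+1) (insert_at j x s) ->
  contains (iota 1 k) s.
Proof.
move=> xs /contains_increasingP[t [tw st szt]].
have ut : uniq t by apply: sorted_uniq st; [exact: ltn_trans | exact: ltnn].
apply: (contains_increasing_leq (t := rem x t)).
- rewrite rem_filter //; have <- : [seq y <- insert_at j x s | predC1 x y] = s.
    rewrite filter_cat /= eqxx -filter_cat cat_take_drop.
    by apply/all_filterP/allP => y ys; apply: contraNneq xs => <-.
  by rewrite subseq_filter filter_all (subseq_trans (filter_subseq _ _) tw).
- by apply: (subseq_sorted _ (rem_subseq _ _)) st; apply: ltn_trans.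
- by case: (boolP (x \in t)) => xt; [rewrite size_rem // szt | rewrite rem_id ?szt].
Qed.

(** * Permutations avoiding 123 *)

Lemma iotaSr i m : iota i m.+1 = rcons (iota i m) (i + m).
Proof. by rewrite -addn1 iotaD cats1. Qed.

Fixpoint decreasing_prefix (w : seq nat) : nat :=
  if w is x :: w' then
    (if w' is y :: _ then (if y < x then decreasing_prefix w' else 0) else 0).+1
  else 0.

Lemma decreasing_prefix_size w : decreasing_prefix w <= size w.
Proof. by elim: w => //= x [|y w] IH //; case: ifP. Qed.

Lemma sorted_take_decreasing_prefix j w :
  j <= size w -> sorted gtn (take j w) = (j <= decreasing_prefix w).
Proof.
elim: w j => [|x w IH] [|j] //=; rewrite ltnS => jw; rewrite ltnS.
case: j w IH jw => [|j] [|y w] //= IH jw.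
by have := IH j.+1 jw; rewrite /=; case: ifP => //= _ ->.
Qed.

(** A new maximum in front prolongs the decreasing run. At a place [j > 0] it makes an ascent right
    after the first [j] letters and cuts the run there. *)
Lemma decreasing_prefix_insert_max x j w :
  all (gtn x) w -> j <= decreasing_prefix w ->
  decreasing_prefix (insert_at j x w) =
    if j is 0 then (decreasing_prefix w).+1 else j.
Proof.
rewrite /insert_at; case: j => [|j]; first by case: w => //= y w /andP[-> _].
elim: w j => [|y w IH] [|j] //= /andP[yx wx].
  by rewrite take0 /= [x < y]ltnNge (ltnW yx).
case: w IH wx => [|z w] //= IH wx; case: ifP => //= zy jw.
by rewrite -[in RHS](IH j wx) //= zy.
Qed.

Fixpoint avoiders123 (m : nat) : seq (seq nat) :=
  if m is m'.+1 then
    [seq insert_at j m w | w <- avoiders123 m',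
                           j <- iota 0 (decreasing_prefix w).+1]
  else [:: [::]].

Lemma avoiders123S m :
  avoiders123 m.+1 = [seq insert_at j m.+1 w | w <- avoiders123 m,
                                       j <- iota 0 (decreasing_prefix w).+1].
Proof. by []. Qed.

(** As [x] does not recur in [s2], the final [x] is matched at the displayed one or earlier, and [s]
    before that. *)
Lemma subseq_rcons_cat (T : eqType) (x : T) s s1 s2 :
  x \notin s2 -> subseq (rcons s x) (s1 ++ x :: s2) -> subseq s s1.
Proof.
move=> xs2; elim: s1 s => [|z s1 IH] [|y s] //=; last first.
  by case: ifP => _; [exact: IH | exact: (IH (y :: s))].
case: eqVneq => [_|_] /mem_subseq/(_ x); rewrite ?inE mem_rcons inE eqxx ?orbT.
  by rewrite (negPf xs2) => /(_ isT).
by rewrite (negPf xs2) => /(_ isT).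
Qed.

Lemma sorted_gtn_or_ascent s :
  uniq s -> (forall x y, subseq [:: x; y] s -> ~~ (x < y)) -> sorted gtn s.
Proof.
elim: s => //= x s IH /andP[xs us] noasc.
rewrite path_sortedE; last by move=> a b c /=; lia.
rewrite IH // ?andbT => [|a b ab]; last first.
  by apply: noasc; apply: subseq_trans ab (subseq_cons _ _).
apply/allP => y ys /=; have := noasc x y; rewrite eqxx sub1seq ys => /(_ isT).
by rewrite -leqNgt leq_eqVlt; case: eqVneq => // yx; rewrite -yx ys in xs.
Qed.

(** The new maximum can only play the 3 of a 123, so it completes one exactly when an ascent
    precedes it, that is, when the first [j] letters are not decreasing. *)
Lemma contains123_insert_max x j w :
  uniq w -> all (gtn x) w -> j <= size w ->
  contains [:: 1; 2; 3] (insert_at j x w) =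
    contains [:: 1; 2; 3] w || (decreasing_prefix w < j).
Proof.
move=> uw wx jw; have xw : x \notin w by apply/negP => /(allP wx) /=; rewrite ltnn.
rewrite ltnNge -sorted_take_decreasing_prefix //.
apply/idP/orP => [/(contains_increasingP 3)[t [tw st szt]]|[]]; last 2 first.
- exact: (@contains_increasing_subseq 3 _ _ (subseq_insert_at _ _ _)).
- apply: contraR => noc; apply: sorted_gtn_or_ascent => [|a b ab]; first exact: take_uniq.
  apply: contra noc => lt_ab; apply: (contains_increasing_leq (k := 3) (t := [:: a; b; x])) => //.
    rewrite /insert_at -[[:: a; b; x]]/([:: a; b] ++ [:: x]).
    by rewrite cat_subseq //= eqxx sub0seq.
  have /(allP wx)/= bx : b \in w.
    by apply: (mem_subseq (take_subseq w j)); apply: (mem_subseq ab); rewrite !inE eqxx orbT.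
  by rewrite /= lt_ab bx.
- have [xt|xt] := boolP (x \in t); last first.
    left; apply: (contains_increasing_leq (k := 3) (t := t)); rewrite ?szt //.
    have := subseq_filter t (insert_at j x w) (predC1 x).
    rewrite tw andbT /insert_at filter_cat /= eqxx -filter_cat cat_take_drop.
    have /all_filterP -> : all (predC1 x) w.
      by apply/allP => y yw; apply: contraNneq xw => <-.
    by move=> ->; apply/allP => y yt; apply: contraNneq xt => <-.
  right; case: t tw st szt xt => [|a [|b [|c []]]] //= tw /and3P[ab bc _] _ xt.
  have tx y : y \in [:: a; b; c] -> y <= x.
    move=> /(mem_subseq tw); rewrite (perm_mem (perm_insert_at _ _ _)) inE.
    by case/predU1P => [-> //|/(allP wx)/ltnW].
  have [bx cx] : b <= x /\ c <= x by split; apply: tx; rewrite !inE eqxx ?orbT.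
  (* The maximum [x] belongs to the increasing triple and bounds its letters, so it is the last of
     them. *)
  have E : x = c by move: xt; rewrite !inE => /or3P[] /eqP; lia.
  rewrite -{}E in tw.
  have abw : subseq [:: a; b] (take j w).
    apply: (@subseq_rcons_cat _ x _ _ (drop j w)) => //.
    by apply: contra xw => /mem_drop.
  have gt_trans : transitive gtn by move=> y z t /=; lia.
  by apply/negP => /(subseq_sorted gt_trans abw) /=; lia.
Qed.

Lemma mem_avoiders123 m w :
  (w \in avoiders123 m) =
    perm_eq w (iota 1 m) && ~~ contains [:: 1; 2; 3] w.
Proof.
elim: m w => [|m IH] w.
  rewrite inE; apply/eqP/andP => [->|[/perm_nilP //]]; split=> //.
  by apply/negP => /(contains_increasingP 3)[t [/eqP]]; case: t.
have max v : perm_eq v (iota 1 m) -> all (gtn m.+1) v.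
  move=> vp; apply/allP => y; rewrite (perm_mem vp) mem_iota /=; lia.
have iotaS : perm_eq (m.+1 :: iota 1 m) (iota 1 m.+1).
  by rewrite iotaSr add1n perm_sym perm_rcons.
apply/allpairsPdep/andP => [[v [j [vm]]]|[wp wa]].
  rewrite (mem_iota 0) add0n ltnS /= => jv ->; move: vm; rewrite IH => /andP[vp va].
  split.
    by rewrite (perm_trans (perm_insert_at _ _ _)) // -(permPr iotaS) perm_cons.
  rewrite contains123_insert_max ?(negPf va) ?max //=.
  - by rewrite -leqNgt.
  - by rewrite (perm_uniq vp) iota_uniq.
  - exact: leq_trans jv (decreasing_prefix_size _).
have mw : m.+1 \in w by rewrite (perm_mem wp) mem_iota /=; lia.
(* Deleting the maximum gives the parent of [w] in the generating tree; its place tells which child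
   [w] is. *)
pose v := rem m.+1 w; pose j := index m.+1 w.
have E : insert_at j m.+1 v = w := insert_at_rem mw.
have vp : perm_eq v (iota 1 m).
  by rewrite -(perm_cons m.+1) (permPr iotaS) -(permPl (perm_insert_at j _ _)) E.
have jv : j <= size v by rewrite -ltnS -(size_insert_at j m.+1) E index_mem.
move: wa; rewrite -E contains123_insert_max ?max // ?(perm_uniq vp) ?iota_uniq //.
rewrite negb_or -leqNgt => /andP[va jd].
by exists v, j; rewrite IH vp va mem_iota.
Qed.

Lemma uniq_avoiders123 m : uniq (avoiders123 m).
Proof.
elim: m => [//|m IH].
apply: (allpairs_uniq_dep (f := fun w j => insert_at j m.+1 w)) => // [w _|].
  exact: iota_uniq.
move=> [v i] [w j] /allpairsPdep[v' [i' [vm im [-> ->]]]].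
move=> /allpairsPdep[w' [j' [wm jm [-> ->]]]] /=.
have max u : u \in avoiders123 m -> m.+1 \notin u.
  by rewrite mem_avoiders123 => /andP[up _]; rewrite (perm_mem up) mem_iota; lia.
have le k u : k \in iota 0 (decreasing_prefix u).+1 -> k <= size u.
  by rewrite mem_iota ltnS => /leq_trans; apply; exact: decreasing_prefix_size.
by move=> /insert_at_inj[] //; rewrite ?max ?le // => -> ->.
Qed.

(* [ballot k d] counts the permutations obtained after k further insertions of
   a new maximum into an avoider whose decreasing prefix has length d. *)
Fixpoint ballot (k d : nat) : nat :=
  if k is k'.+1 then \sum_(e <- iota 1 d.+1) ballot k' e else 1.

(** By the recursion of [ballot], the children of [w] together contribute [ballot k.+1] at the
    prefix length of [w], so one generation moves from [m] to [k]. At the root only the empty word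
    remains, with prefix length 0. *)
Lemma sum_ballot k m :
  \sum_(w <- avoiders123 m) ballot k (decreasing_prefix w) = ballot (m + k) 0.
Proof.
elim: m k => [|m IH] k; first by rewrite big_seq1.
rewrite addSnnS -IH avoiders123S big_allpairs_dep /=; apply: eq_big_seq => w wm.
have max : all (gtn m.+1) w.
  move: wm; rewrite mem_avoiders123 => /andP[wp _].
  by apply/allP => y; rewrite (perm_mem wp) mem_iota /=; lia.
rewrite big_cons decreasing_prefix_insert_max //.
(* Insertion in front gives the largest prefix length, so the first term on the left is the last one
   on the right. *)
rewrite -[X in _ = \sum_(e <- X) _]/(iota 1 (decreasing_prefix w).+1) iotaSr big_rcons /= add1n addnC.
congr (_ + _); apply: eq_big_seq => -[|e]; rewrite mem_iota // add1n ltnS /= => ew.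
by rewrite decreasing_prefix_insert_max.
Qed.

Lemma size_avoiders123 m : size (avoiders123 m) = ballot m 0.
Proof. by rewrite -[m in RHS]addn0 -sum_ballot sum1_size. Qed.

(* The reflection principle, with the subtraction moved to the left. *)
Lemma ballot_bin k d :
  ballot k d + (if k is k'.+1 then 'C(k.*2 + d, k') else 0) = 'C(k.*2 + d, k).
Proof.
(* Pascal's rule, with the term at [j - 1] read as zero when [j = 0]. *)
have pascal n j : 'C(n.+1, j) = 'C(n, j) + (if j is j'.+1 then 'C(n, j') else 0).
  by case: j => [|j]; rewrite ?bin0 // binS.
elim: k d => [|k IH] d; first by rewrite bin0.
elim: d => [|d IHd].
  (* For [d = 0] the only summand is [ballot k 1]; the symmetry of row 2k + 1 about its middle makes
     the binomials match. *)
  have sym : 'C(k.*2.+1, k.+1) = 'C(k.*2.+1, k).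
    by rewrite -bin_sub; [congr 'C(_, _) |]; lia.
  have := IH 1; rewrite /= big_seq1 doubleS addn0 addn1 binS sym.
  by rewrite (pascal k.*2.+1 k); lia.
have {IHd} : ballot k.+1 d + 'C(k.*2 + d.+2, k) = 'C(k.*2 + d.+2, k.+1).
  by move: IHd; rewrite doubleS !addSn !addnS.
(* One more summand appears when [d] grows by one, which turns the sum into a Pascal-like
   recurrence. *)
have -> : ballot k.+1 d.+1 = ballot k.+1 d + ballot k d.+2.
  by rewrite /= -[1 :: _]/(iota 1 d.+2) iotaSr big_rcons /= addnC add1n.
have := IH d.+2; rewrite doubleS !addSn -!addnS [k.*2 + d.+3]addnS binS pascal; lia.
Qed.

(** For [m = k + 1], [ballot m 0] is C(2m, m) - C(2m, k), and (m + 1) C(2m, k) = m C(2m, m). *)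
Lemma catalan_ballot m : m.+1 * ballot m 0 = 'C(m.*2, m).
Proof.
have := ballot_bin m 0; rewrite addn0; case: m => [|k]; first by rewrite addn0 mul1n.
have := mul_bin_left k.+1.*2 k; rewrite -addnn; nia.
Qed.

(** * Filling the hole *)

Lemma one_line_surj n (o : seq nat) :
  uniq o -> size o = n -> all (fun x => 0 < x <= n) o ->
  exists s : 'S_n, one_line s = o.
Proof.
move=> uo szo bo.
have nth_o k : k < n -> 0 < nth 0 o k <= n.
  by move=> kn; apply: (allP bo); rewrite mem_nth ?szo.
have nth_oK k : k < n -> (nth 0 o k).-1.+1 = nth 0 o k.
  by move=> /nth_o/andP[+ _]; exact: prednK.
have ltn_o (i : 'I_n) : (nth 0 o i).-1 < n.
  by rewrite nth_oK //; case/andP: (nth_o i (ltn_ord i)).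
pose f i := Ordinal (ltn_o i).
have finj : injective f.
  move=> i j /(congr1 val) /= /(congr1 S); rewrite !nth_oK // => /eqP.
  by rewrite nth_uniq ?szo // => /eqP/val_inj.
exists (perm finj); apply: (@eq_from_nth _ 0).
  by rewrite size_map size_enum_ord szo.
rewrite size_map size_enum_ord => k kn.
by rewrite (nth_map (Ordinal kn)) ?size_enum_ord // permE /= nth_enum_ord // nth_oK.
Qed.

Definition erase (T : Type) (j : nat) (s : seq T) : seq T :=
  take j s ++ drop j.+1 s.

Lemma erase_insert_at (T : Type) j (x : T) s :
  j <= size s -> erase j (insert_at j x s) = s.
Proof.
move=> js; rewrite /erase /insert_at take_size_cat ?size_takel //.
by rewrite -cat_rcons drop_size_cat ?cat_take_drop // size_rcons size_takel.
Qed.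

Lemma insert_at_erase (T : Type) x0 j (s : seq T) :
  j < size s -> insert_at j (nth x0 s j) (erase j s) = s.
Proof.
move=> js; rewrite /erase /insert_at take_size_cat ?drop_size_cat ?size_takel 1?ltnW //.
by rewrite -drop_nth // cat_take_drop.
Qed.

(** Forgetting the bound on the entries allows words to be built and compared as plain lists. *)
Definition word_of n (w : n.-tuple (option 'I_n)) : seq (option nat) :=
  map (omap (@nat_of_ord n)) w.

Lemma word_of_inj n : injective (@word_of n).
Proof.
move=> w1 w2 /inj_map E; apply/val_inj/E => -[x|] [y|] //= [] /val_inj -> //.
Qed.

Definition hole_word (j : nat) (u : seq nat) : seq (option nat) :=
  insert_at j None (map Some u).

Lemma hole_word_inj i j s t : i <= size s -> j <= size t ->
  hole_word i s = hole_word j t -> i = j /\ s = t.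
Proof.
have noNone (u : seq nat) : None \notin map Some u by apply/mapP => -[].
move=> ils jlt /insert_at_inj[]; rewrite ?size_map // => -> /inj_map -> //.
by move=> x y [].
Qed.

Lemma pmap_hole_word j u : pmap id (hole_word j u) = u.
Proof.
rewrite /hole_word /insert_at pmap_cat /= -pmap_cat cat_take_drop.
by elim: u => //= x u ->.
Qed.

Lemma pmap_word_of n (w : n.-tuple (option 'I_n)) :
  [seq nat_of_ord v | v <- pmap id w] = pmap id (word_of w).
Proof. by rewrite /word_of; elim: (tval w) => //= -[x|] s //= ->. Qed.

(** The mask of non-hole positions is true except at [j], so restricting to it erases the letter at
    [j]. *)
Lemma extension_hole_word n (w : n.-tuple (option 'I_n)) (s : 'S_n) j u :
  word_of w = hole_word j u -> j <= size u ->
  extension w s = (standardize (erase j (one_line s)) == u).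
Proof.
move=> E ju; rewrite /extension pmap_word_of E pmap_hole_word.
congr (standardize _ == _).
rewrite filter_mask map_mask -/(one_line s).
have -> : [seq tnth w i != None | i <- enum 'I_n] = map isSome (word_of w).
  rewrite /word_of -[in RHS](map_tnth_enum w) -!map_comp.
  by apply: eq_map => i /=; case: (tnth w i).
have szn : n = (size u).+1.
  by rewrite -(size_tuple w) -(size_map (omap (@nat_of_ord n)) w) [map _ _]E size_insert_at size_map.
have szo : size (one_line s) = n by rewrite size_map size_enum_ord.
have trueT (r : seq nat) : map isSome (map Some r) = nseq (size r) true.
  by elim: r => //= x r ->.
rewrite E map_insert_at trueT -{1}(insert_at_erase 0 (_ : j < size (one_line s))); last first.
  by rewrite szo szn.
rewrite /insert_at mask_cat; last first.
  by rewrite /erase take_size_cat !size_takel ?size_nseq // szo szn ltnW.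
have sze : size (erase j (one_line s)) = size u.
  by rewrite size_cat size_drop size_takel; rewrite ?szo ?szn; lia.
rewrite /= take_nseq // drop_nseq !mask_true ?size_drop ?sze ?size_takel ?sze //.
exact: cat_take_drop.
Qed.

Lemma one_hole_word m (w : (m.+1).-tuple (option 'I_m.+1)) :
  reflect (exists j u, [/\ j <= m, perm_eq u (iota 1 m) & word_of w = hole_word j u])
    (one_hole w).
Proof.
have cN : count_mem None w = count_mem None (word_of w).
  by rewrite count_map; apply: eq_count => -[].
have cS (v : 'I_m.+1) : count_mem (Some v) w = count_mem (Some (v : nat)) (word_of w).
  by rewrite count_map; apply: eq_count => -[x|].
have cU j u x : count_mem (Some x) (hole_word j u) = count_mem x u.
  rewrite (seq.permP (perm_insert_at _ _ _)) /= add0n count_map.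
  by apply: eq_count.
apply: (iffP andP) => [[/eqP c1 /forallP cv]|[j [u [jm up E]]]]; last first.
  have uu : uniq u by rewrite (perm_uniq up) iota_uniq.
  split.
    rewrite cN E (seq.permP (perm_insert_at _ _ _)) /= count_map.
    by rewrite (eq_count (a2 := pred0)) ?count_pred0.
  apply/forallP => v; apply/implyP => v0; rewrite cS E cU count_uniq_mem //.
  by rewrite (perm_mem up) mem_iota v0 add1n ltn_ord.
pose u := pmap id (word_of w); pose j := index None (word_of w).
have Nw : None \in word_of w by rewrite -has_pred1 has_count -cN c1.
have E : word_of w = hole_word j u.
  rewrite -[LHS](insert_at_rem Nw) /hole_word; congr insert_at.
  (* The hole is unique, so once it is removed every entry is a [Some] and [pmap id] loses
     nothing. *)
  have: None \notin rem None (word_of w).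
    by apply/count_memPn; rewrite count_mem_rem -cN c1 eqxx.
  rewrite /u -[X in pmap id X](insert_at_rem Nw).
  rewrite /insert_at pmap_cat /= -pmap_cat cat_take_drop.
  by elim: (rem _ _) => //= -[x|] r IH //=; rewrite inE /= => /IH <-.
have szu : size u = m.
  have : size (word_of w) = m.+1 by rewrite size_map size_tuple.
  by rewrite E size_insert_at size_map => -[].
exists j, u; split=> //.
  by rewrite -ltnS -[m.+1](size_tuple w) -(size_map (omap (@nat_of_ord _)) w) index_mem.
(* All of 1, ..., m occur among the [m] letters of [u], which leaves no room for 0 or a
   repetition. *)
have sub : {subset iota 1 m <= u}.
  move=> x; rewrite mem_iota add1n => /andP[x0 xm].
  have := cv (Ordinal xm); rewrite x0 cS E cU /= => /eqP c.
  by rewrite -has_pred1 has_count c.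
have szle : size u <= size (iota 1 m) by rewrite szu size_iota.
rewrite perm_sym; apply: uniq_perm; first exact: iota_uniq.
  exact: leq_size_uniq (iota_uniq 1 m) sub szle.
by have [] := uniq_min_size (iota_uniq 1 m) sub szle.
Qed.

Lemma bump_mono v : {mono bump v : x y / x <= y}.
Proof. by move=> x y; rewrite leq_bump2. Qed.

Lemma extension_with_increasing m u j :
  perm_eq u (iota 1 m) -> j <= m -> contains [:: 1; 2; 3] u ->
  exists s : 'S_m.+1, standardize (erase j (one_line s)) = u /\
    contains [:: 1; 2; 3; 4] (one_line s).
Proof.
move=> up jm /(contains_increasingP 3)[t [tu st szt]].
have szu : size u = m by rewrite (perm_size up) size_iota.
(* Cut the triple into its letters before the hole and those after it; either part may be empty. *)
have [t1 [t2 [Et t1u t2u]]] :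
    exists t1 t2, [/\ t = t1 ++ t2, subseq t1 (take j u) & subseq t2 (drop j u)].
  case/subseqP: tu => b szb Et; exists (mask (take j b) (take j u)), (mask (drop j b) (drop j u)).
  rewrite !mask_subseq -mask_cat ?cat_take_drop //.
  by rewrite !size_take szb.
have bu x : x \in u -> 0 < x <= m by rewrite (perm_mem up) mem_iota; lia.
(* The hole receives the value just above the last letter of the increasing
   triple that precedes it. *)
pose v := (last 0 t1).+1.
have vm : v <= m.+1.
  rewrite /v ltnS; have : last 0 t1 \in 0 :: t1 := mem_last _ _.
  by rewrite inE => /predU1P[-> //|/(mem_subseq t1u)/mem_take/bu]; lia.
(* [bump v] raises the letters from [v] on by one: it keeps the order, so that erasing the hole
   gives back [u], and it frees the value [v]. *)
pose o := insert_at j v (map (bump v) u).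
have mo x : x \in o -> 0 < x <= m.+1.
  rewrite (perm_mem (perm_insert_at _ _ _)) inE => /predU1P[->|/mapP[y /bu]]; first by lia.
  by rewrite /bump => ? ->; lia.
have uo : uniq o.
  rewrite (perm_uniq (perm_insert_at _ _ _)) /= map_inj_uniq; last exact: can_inj (bumpK v).
  rewrite (perm_uniq up) iota_uniq andbT; apply/mapP => -[y _] /eqP.
  by rewrite (negPf (neq_bump _ _)).
have szo : size o = m.+1 by rewrite size_insert_at size_map szu.
have [s Es] := one_line_surj uo szo (introT allP mo).
exists s; rewrite Es; split.
  rewrite erase_insert_at ?size_map ?szu // standardize_map; last first.
    by move=> x y _ _; exact: bump_mono.
  exact: standardize_perm_iota up.
have := st; rewrite Et (sorted_pairwise ltn_trans) pairwise_cat.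
case/and3P => /allrelP a12 p1 p2.
have lt1 x : x \in t1 -> x < v.
  rewrite /v ltnS; move: p1; rewrite -(sorted_pairwise ltn_trans).
  case/lastP: (t1) => // r y; rewrite last_rcons (sorted_pairwise ltn_trans) pairwise_rcons.
  by case/andP=> /allP ry _; rewrite mem_rcons inE => /predU1P[->//|/ry/ltnW].
have gt2 x : x \in t2 -> v <= x.
  move=> xt; have /andP[x0 _] : 0 < x <= m.
    by apply: bu; apply: mem_drop (mem_subseq t2u xt).
  (* If [t1] is empty, the default 0 makes [v] equal to 1 and positivity of [x] suffices; otherwise
     [x] exceeds the last letter of [t1]. *)
  rewrite /v; have := mem_last 0 t1; rewrite inE => /predU1P[-> //|lt].
  exact: a12.
apply: (contains_increasing_leq (k := 4)
  (t := map (bump v) t1 ++ v :: map (bump v) t2)).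
- by rewrite /o /insert_at -map_take -map_drop cat_subseq ?map_subseq //= eqxx map_subseq.
- rewrite (sorted_pairwise ltn_trans).
  have tr r : pairwise ltn (map (bump v) r) = pairwise ltn r.
    rewrite pairwise_map; apply: eq_pairwise => x y /=.
    by rewrite !ltnNge leq_bump2.
  rewrite pairwise_cat /= !tr p1 p2 /= !andbT.
  have -> /= : all (ltn v) (map (bump v) t2).
    by apply/allP => x /mapP[y /gt2 yv ->]; rewrite /bump yv /=; lia.
  rewrite andbT; apply/allrelP => x y /mapP[z zt ->].
  rewrite inE => /predU1P[->|/mapP[z' z't ->]].
    by rewrite /bump [v <= z]leqNgt lt1 //= lt1.
  by rewrite ltnNge leq_bump2 -ltnNge; exact: a12.
- by rewrite size_cat /= !size_map addnS -size_cat -Et szt.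
Qed.

Lemma avoids_hole_word m (w : (m.+1).-tuple (option 'I_m.+1)) j u :
  word_of w = hole_word j u -> perm_eq u (iota 1 m) -> j <= m ->
  avoids w [:: 1; 2; 3; 4] = ~~ contains [:: 1; 2; 3] u.
Proof.
move=> E up jm; have szu : size u = m by rewrite (perm_size up) size_iota.
apply/forallP/idP => [av|nc s].
  apply/negP => /(extension_with_increasing up jm)[s [su sc]].
  by have := av s; rewrite (extension_hole_word _ E) ?szu // su eqxx sc.
apply/implyP; rewrite (extension_hole_word _ E) ?szu // => /eqP su.
(* A 1234 in the extension leaves a 123 after erasing the letter at the hole, and standardizing
   keeps it. *)
apply: contra nc; rewrite -su => c; apply: (@contains_increasing_standardize 3).
have js : j < size (one_line s) by rewrite size_map size_enum_ord ltnS.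
apply: (@contains_increasing_insert 3 j (nth 0 (one_line s) j)); last by rewrite insert_at_erase.
have : uniq (one_line s).
  by rewrite map_inj_uniq ?enum_uniq // => x y [/val_inj/perm_inj].
by rewrite -{1}(insert_at_erase 0 js) (perm_uniq (perm_insert_at _ _ _)) => /andP[].
Qed.

(** * Lattice paths *)

Definition up : int * int := (1, 1)%R.
Definition down : int * int := (1, -1)%R.

(** Here [k] is the number of steps and [a] that of up steps; the recursion on the first step
    mirrors Pascal's rule. *)
Fixpoint paths (k a : nat) : seq (seq (int * int)) :=
  if k is k'.+1 then
    map (cons down) (paths k' a) ++
    (if a is a'.+1 then map (cons up) (paths k' a') else [::])
  else if a is 0 then [:: [::]] else [::].

Lemma size_paths k a : size (paths k a) = 'C(k, a).
Proof.
elim: k a => [|k IH] [|a] //=; rewrite size_cat !size_map !IH ?bin0 //.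
Qed.

Lemma uniq_paths k a : uniq (paths k a).
Proof.
have inj (x : int * int) : injective (cons x) by move=> s t [].
elim: k a => [|k IH] [|a] //=; rewrite ?cats0 ?cat_uniq !map_inj_uniq ?IH //= andbT.
by apply/hasPn => _ /mapP[s _ ->]; apply/mapP => -[t _].
Qed.

Lemma mem_paths k a t :
  (t \in paths k a) =
    [&& all (fun u => u \in [:: up; down]) t, size t == k & count_mem up t == a].
Proof.
have consE (x y : int * int) s L : (x :: s \in map (cons y) L) = (x == y) && (s \in L).
  apply/mapP/andP => [[s' sL [-> ->]]|[/eqP-> sL]]; first by rewrite eqxx.
  by exists s.
elim: k a t => [|k IH] a [|x t] /=; rewrite ?mem_cat.
- by case: a.
- by case: a => [|a]; rewrite !inE ?andbF.
- by apply/negbTE/norP; split; [|case: a => // a]; apply/mapP => -[].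
rewrite consE IH eqSS !inE; case: (eqVneq x up) => [->|xu] /=; last first.
  by case: a => [|a]; rewrite ?consE ?(negPf xu) ?in_nil /= orbF andbA.
by case: a => [|a]; rewrite ?consE ?eqxx ?in_nil ?IH ?andbF //= add1n eqSS.
Qed.

Lemma sum_steps t : all (fun u => u \in [:: up; down]) t ->
  (\sum_(u <- t) u = ((size t)%:Z, (count_mem up t)%:Z *+ 2 - (size t)%:Z))%R.
Proof.
elim: t => [|x t IH] /=; first by rewrite big_nil.
rewrite big_cons => /andP[xs /IH ->].
by move: xs; rewrite !inE => /orP[] /eqP -> /=; congr pair => /=; lia.
Qed.

(** The abscissa counts the steps and the height is twice the up steps minus all steps, so the
    endpoint forces 2m steps with [m] of them up. *)
Lemma mem_paths_lattice m t :
  (t \in paths m.*2 m) =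
    lattice_path [:: up; down] (0, 0)%R (2 * m.+1%:Z - 2, 0)%R t.
Proof.
have arith (a b : nat) : (a == m.*2) && (b == m) =
    ((a%:Z == 2 * m.+1%:Z - 2) && (b%:Z *+ 2 - a%:Z == 0))%R by lia.
rewrite mem_paths /lattice_path; case: (boolP (all _ t)) => //= /sum_steps ->.
by rewrite [in RHS](add0r (_ : int * int)) xpair_eqE arith.
Qed.

(** * The bijection *)

Definition hole_words (m : nat) : seq (seq (option nat)) :=
  [seq hole_word j u | u <- avoiders123 m, j <- iota 0 m.+1].

Lemma hole_wordsP m v :
  reflect (exists j u, [/\ j <= m, perm_eq u (iota 1 m),
                         ~~ contains [:: 1; 2; 3] u & v = hole_word j u])
    (v \in hole_words m).
Proof.
apply: (iffP idP) => [/allpairsPdep[u [j [um]]]|[j [u [jm up uc ->]]]].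
  rewrite (mem_iota 0) => jm ->; exists j, u.
  by move: um; rewrite mem_avoiders123 => /andP[].
by apply/allpairsPdep; exists u, j; rewrite mem_avoiders123 (mem_iota 0) up uc.
Qed.

Lemma uniq_hole_words m : uniq (hole_words m).
Proof.
apply: (allpairs_uniq (f := fun u j => hole_word j u)).
- exact: uniq_avoiders123.
- exact: iota_uniq.
move=> [u i] [v j] /allpairsPdep[u' [i' [um im [-> ->]]]].
move=> /allpairsPdep[v' [j' [vm jm [-> ->]]]].
have sz w : w \in avoiders123 m -> size w = m.
  by rewrite mem_avoiders123 => /andP[/perm_size -> _]; rewrite size_iota.
move: im jm; rewrite !(mem_iota 0) /= => im jm.
by move=> /= /hole_word_inj[||-> ->] //; rewrite sz.
Qed.

Lemma size_hole_words m : size (hole_words m) = 'C(m.*2, m).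
Proof. by rewrite size_allpairs size_iota size_avoiders123 mulnC catalan_ballot. Qed.

Lemma mem_hole_words m (w : (m.+1).-tuple (option 'I_m.+1)) :
  (word_of w \in hole_words m) = one_hole w && avoids w [:: 1; 2; 3; 4].
Proof.
apply/hole_wordsP/andP => [[j [u [jm up uc E]]]|[/one_hole_word[j [u [jm up E]]]]].
  split; first by apply/one_hole_word; exists j, u.
  by rewrite (avoids_hole_word E up jm).
by rewrite (avoids_hole_word E up jm) => uc; exists j, u.
Qed.

Lemma word_of_surj m v : v \in hole_words m ->
  exists w : (m.+1).-tuple (option 'I_m.+1), word_of w = v.
Proof.
case/hole_wordsP => j [u [_ up _ ->]].
have sz : size (map (omap (@inord m)) (hole_word j u)) == m.+1.
  by rewrite size_map size_insert_at size_map (perm_size up) size_iota.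
exists (Tuple sz); rewrite /word_of /= -map_comp map_id_in // => -[x|] //= xu.
rewrite inordK //; move: xu; rewrite (perm_mem (perm_insert_at _ _ _)) inE /=.
by case/mapP => y yu [->]; move: yu; rewrite (perm_mem up) mem_iota => /andP[].
Qed.

Theorem theorem35 (n : nat) (hn : 1 <= n) :
  exists f : {w : n.-tuple (option 'I_n)
               | one_hole w && avoids w [:: 1; 2; 3; 4]} ->
             {t : seq (int * int)
               | lattice_path [:: (1, 1); (1, -1)]%R
                   (0, 0)%R (2 * n%:Z - 2, 0)%R t},
    bijective f.
Proof.
case: n hn => // m _.
pose P (w : (m.+1).-tuple (option 'I_m.+1)) := one_hole w && avoids w [:: 1; 2; 3; 4].
apply: (@bijective_of_lists _ _ P _ (enum P) (paths m.*2 m)).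
- exact: enum_uniq.
- exact: uniq_paths.
- by move=> w; rewrite mem_enum.
- exact: mem_paths_lattice.
(* It remains to count the avoiding partial permutations: the injection [word_of] carries them onto
   the list [hole_words m]. *)
rewrite size_paths -size_hole_words -(size_map (@word_of m.+1)).
apply/perm_size/uniq_perm; last 1 first.
- move=> v; apply/mapP/idP => [[w]|vm].
    by rewrite mem_enum => Pw ->; rewrite mem_hole_words.
  have [w E] := word_of_surj vm; exists w => //.
  by move: vm; rewrite mem_enum -E mem_hole_words.
- by rewrite map_inj_uniq ?enum_uniq //; exact: word_of_inj.
- exact: uniq_hole_words.
Qed.
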